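(* Let $(\Sigma,\mathcal F)$ be a measurable space, $\mathcal M_S$ a $\mathrm W^*$-algebra, and $f:\Sigma\to\mathcal M_S$ an ultraweakly $\mathcal F$-measurable function that is unbounded, i.e. $\sup_{x\in\Sigma}\|f(x)\|=\infty$. Then there exist a $\mathrm W^*$-algebra $\mathcal M_R$ and a POVM $\mathsf E:\mathcal F\to\mathrm{Eff}(\mathcal M_R)$ for which there is no (bounded) element $A\in\mathcal M_S\bar\otimes\mathcal M_R$ satisfying the characterizing formula $$(\rho\otimes\omega)(A)=\int_\Sigma f_\rho\,d\mathsf E_\omega\qquad\text{for all normal states }\rho\text{ of }\mathcal M_S\text{ and }\omega\text{ of }\mathcal M_R .$$
   Context: $\mathrm{Eff}(\mathcal M)=\{E\in\mathcal M:0\le E\le 1\}$. $f$ is ultraweakly $\mathcal F$-measurable if $f_\rho:=\rho\circ f$ is $\mathcal F$-measurable for every normal functional $\rho$ on $\mathcal M_S$. A POVM $\mathsf E:\mathcal F\to\mathrm{Eff}(\mathcal M_R)$ is a map such that $\mathsf E_\omega:=\omega\circ\mathsf E$ is a probability measure for every normal state $\omega$ of $\mathcal M_R$. $\mathcal M_S\bar\otimes\mathcal M_R$ is the spatial (von Neumann) tensor product, $\rho\otimes\omega$ the normal product functional. Satisfying the characterizing formula includes that $f_\rho$ is $\mathsf E_\omega$-integrable for all normal states $\rho,\omega$. *)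

(* Defs.v *)
From HB Require Import structures.
From mathcomp Require Import all_boot all_order all_algebra.
From mathcomp Require Import complex.
From mathcomp Require Import all_classical all_reals all_analysis.
Set Implicit Arguments.
Unset Strict Implicit.
Unset Printing Implicit Defensive.
Import Order.TTheory GRing.Theory Num.Theory.
Import numFieldNormedType.Exports.
Local Open Scope classical_set_scope.
Local Open Scope complex_scope.
Local Open Scope ring_scope.

(* Inner products are linear in the first variable and conjugate-linear in the
   second one. *)
HB.mixin Record CompleteNormedModule_isHilbert (R : realType) H
    & CompleteNormedModule R[i] H := {
  inner : {dot H for @Num.conj R[i]} ;
  inner_norm : forall x : H, inner x x = `|x| ^+ 2
}.

#[short(type="hilbertType")]
HB.structure Definition Hilbert (R : realType) :=
  {H of CompleteNormedModule_isHilbert R H & CompleteNormedModule R[i] H}.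

(* A unital C*-algebra.  The product is a field of the mixin because
   Hierarchy Builder accepts no common extension of the normed-module and ring
   hierarchies other than the existing numDomainType. *)
HB.mixin Record CompleteNormedModule_isCStar (R : realType) M
    & CompleteNormedModule R[i] M := {
  cone : M ;
  cmul : M -> M -> M ;
  star : M -> M ;
  cmulA : associative cmul ;
  cmul1r : left_id cone cmul ;
  cmulr1 : right_id cone cmul ;
  cmul_linearl : forall b : M, linear (cmul^~ b) ;
  cmul_linearr : forall a : M, linear (cmul a) ;
  cmul_norm : forall a b : M, `|cmul a b| <= `|a| * `|b| ;
  starK : involutive star ;
  star_semilinear : forall (c : R[i]) (a b : M),
    star (c *: a + b) = c^* *: star a + star b ;
  starM : forall a b : M, star (cmul a b) = cmul (star b) (star a) ;
  cstar_identity : forall a : M, `|cmul (star a) a| = `|a| ^+ 2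
}.

#[short(type="cstarType")]
HB.structure Definition CStar (R : realType) :=
  {M of CompleteNormedModule_isCStar R M & CompleteNormedModule R[i] M}.

Section von_neumann.
Context {R : realType}.
Implicit Types (H K L : hilbertType R) (M N : cstarType R).

Definition bounded_operator H (T : H -> H) : Prop := linear T /\ continuous T.

Definition adjoint_of H (T T' : H -> H) : Prop :=
  forall x y : H, inner (T x) y = inner x (T' y).

Definition commutant H (S : set (H -> H)) : set (H -> H) :=
  [set T | bounded_operator T /\ forall U, S U -> T \o U = U \o T].

Definition von_neumann_algebra H (A : set (H -> H)) : Prop :=
  [/\ A `<=` @bounded_operator H,
      forall T, A T -> exists2 T', A T' & adjoint_of T T'
    & commutant (commutant A) = A].

Definition star_representation M H (pi : M -> H -> H) : Prop :=
  [/\ forall a, bounded_operator (pi a),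
      forall (c : R[i]) a b x, pi (c *: a + b) x = c *: pi a x + pi b x,
      forall a b x, pi (cmul a b) x = pi a (pi b x),
      forall x, pi cone x = x
    & forall a, adjoint_of (pi a) (pi (star a))].

Definition vn_representation M H (pi : M -> H -> H) : Prop :=
  [/\ star_representation pi, injective pi & von_neumann_algebra (range pi)].

End von_neumann.

(* A W*-algebra: a C*-algebra which has a faithful representation as a von
   Neumann algebra on some Hilbert space. *)
HB.mixin Record CStar_isWStar (R : realType) M & CStar R M := {
  wstar_representable :
    exists (H : hilbertType R) (pi : M -> H -> H), vn_representation pi
}.

#[short(type="wstarType")]
HB.structure Definition WStar (R : realType) :=
  {M of CStar_isWStar R M & CStar R M}.

Section wstar.
Context {R : realType}.
Implicit Types (M N T : wstarType R).

Definition cstar_le M (a b : M) : Prop := exists c : M, b - a = cmul (star c) c.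

Definition Eff M : set M := [set E | cstar_le 0 E /\ cstar_le E cone].

Definition ultraweakly_continuous M (H : hilbertType R) (pi : M -> H -> H)
    (phi : M -> R[i]) : Prop :=
  exists xi eta : nat -> H,
    [/\ cvgn (series (fun n => `|xi n| ^+ 2)),
        cvgn (series (fun n => `|eta n| ^+ 2))
      & forall a, series (fun n => inner (pi a (xi n)) (eta n) : R[i]^o) @ \oo
                    --> (phi a : R[i]^o)].

(* The choice of the representation is immaterial: an isomorphism of von
   Neumann algebras is a homeomorphism for the ultraweak topologies. *)
Definition normal_functional M (phi : M -> R[i]) : Prop :=
  exists (H : hilbertType R) (pi : M -> H -> H),
    vn_representation pi /\ ultraweakly_continuous pi phi.

Record normal_state M := NormalState {
  ns_fun :> M -> R[i] ;
  ns_normal : normal_functional ns_fun ;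
  ns_ge0 : forall a : M, 0 <= ns_fun (cmul (star a) a) ;
  ns_one : ns_fun cone = 1
}.

End wstar.

Section integration.
Context {R : realType} d {Sigma : measurableType d}.

(* The library has no Borel sigma-algebra on R[i] and no complex integral;
   both are taken componentwise. *)
Definition measurableC (g : Sigma -> R[i]) : Prop :=
  measurable_fun setT (fun x => complex.Re (g x)) /\
  measurable_fun setT (fun x => complex.Im (g x)).

Definition integrableC (P : {measure set Sigma -> \bar R})
    (g : Sigma -> R[i]) : Prop :=
  P.-integrable setT (fun x => (complex.Re (g x))%:E) /\
  P.-integrable setT (fun x => (complex.Im (g x))%:E).

Definition integralC (P : {measure set Sigma -> \bar R})
    (g : Sigma -> R[i]) : R[i] :=
  (\int[P]_x complex.Re (g x)) +i* (\int[P]_x complex.Im (g x)).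

Definition ultraweakly_measurable (M : wstarType R) (f : Sigma -> M) : Prop :=
  forall rho : M -> R[i], normal_functional rho ->
    measurableC (fun x => rho (f x)).

End integration.

(* Only the values of [povm_effect] on measurable sets are meaningful;
   [povm_measure E omega] is the probability measure omega o E. *)
Record povm (R : realType) d (Sigma : measurableType d) (M : wstarType R) :=
  Povm {
  povm_effect :> set Sigma -> M ;
  povm_Eff : forall X, measurable X -> Eff (povm_effect X) ;
  povm_measure : normal_state M -> probability Sigma R ;
  povm_measureE : forall (omega : normal_state M) X, measurable X ->
    omega (povm_effect X) = (fine (povm_measure omega X))%:C
}.

Section tensor.
Context {R : realType}.

(* (L, t) is a Hilbert space tensor product of H and K, with t x y = x (x) y. *)
Definition hilbert_tensor (H K L : hilbertType R)
    (t : {bilinear H -> K -> L}) : Prop :=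
  (forall x x' y y', inner (t x y) (t x' y') = inner x x' * inner y y') /\
  dense [set z : L | exists n (x : 'I_n -> H) (y : 'I_n -> K),
                       z = \sum_(i < n) t (x i) (y i)].

(* T, with tau a b = a (x) b, is the spatial tensor product of M and N: in
   some representation on the tensor product of representation spaces of M and
   N, it is the von Neumann algebra generated by the operators a (x) b.  These
   data determine (T, tau) up to a unique isomorphism. *)
Definition spatial_tensor (M N T : wstarType R) (tau : M -> N -> T) : Prop :=
  exists (H K L : hilbertType R) (piM : M -> H -> H) (piN : N -> K -> K)
      (piT : T -> L -> L) (t : {bilinear H -> K -> L}),
    [/\ vn_representation piM, vn_representation piN, vn_representation piT,
        hilbert_tensor t
      & (forall a b x y, piT (tau a b) (t x y) = t (piM a x) (piN b y)) /\
        range piT = commutant (commutant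
          [set U | exists a b, U = piT (tau a b)])].

(* The normal functional rho (x) omega on T; it exists and is unique. *)
Definition product_functional (M N T : wstarType R) (tau : M -> N -> T)
    (rho : M -> R[i]) (omega : N -> R[i]) (phi : T -> R[i]) : Prop :=
  normal_functional phi /\ forall a b, phi (tau a b) = rho a * omega b.

Definition characterizing_formula d (Sigma : measurableType d)
    (M N T : wstarType R) (tau : M -> N -> T) (f : Sigma -> M)
    (E : povm Sigma N) (A : T) : Prop :=
  forall (rho : normal_state M) (omega : normal_state N),
    integrableC (povm_measure E omega) (fun x => rho (f x)) /\
    forall phi : T -> R[i], product_functional tau rho omega phi ->
      phi A = integralC (povm_measure E omega) (fun x => rho (f x)).

End tensor.

(* Main.v *)
(* Take M_R = M_S and E(X) = P(X) 1 for a suitable probability measure P: E_omega = P for every normal state omega and it suffices that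
   f_rho is not P-integrable for some normal state rho.  If a vector state rho
   has |f_rho| unbounded, choose x_n with |Re f_rho(x_n)| (or |Im f_rho(x_n)|)
   larger than n 2^(n+1) and P = sum_n 2^-(n+1) delta_(x_n).

   Such a vector state exists.  Otherwise the quadratic forms <f(x) xi, xi> are
   pointwise bounded, hence uniformly bounded by a Baire argument, so that the
   self-adjoint parts of the operators f(x) have uniformly bounded norm.  This
   transfers to the norm of M_S without spectral theory: if k is self-adjoint
   and has operator norm at most 1/2, the iteration c <- (k^2 + c^2) / 2 converges
   in the bicommutant, so its limit c = 1 - sqrt (1 - k^2) lies in the algebra,
   u = k + i (1 - c) is unitary there, and k, the average of u and its adjoint,
   has norm at most 1. *)

From HB Require Import structures.
Require Import Defs.
From mathcomp Require Import all_boot all_order all_algebra.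
From mathcomp Require Import complex.
From mathcomp Require Import all_classical all_reals all_analysis.
From mathcomp Require Import measurable_realfun.
From mathcomp Require Import ring zify.
Set Implicit Arguments.
Unset Strict Implicit.
Unset Printing Implicit Defensive.
Import Order.TTheory GRing.Theory Num.Theory.
Import numFieldNormedType.Exports.
Local Open Scope classical_set_scope.
Local Open Scope complex_scope.
Local Open Scope ring_scope.

(** * Completeness over the complex numbers *)

Section complete_spaces.
Context {R : realType}.
Local Notation C := R[i].

Lemma complex_archimedean (B : C) : 0 <= B -> exists n, B < n%:R.
Proof.
move=> B0; have BE : (complex.Re B)%:C = B by rewrite (RRe_real (ger0_real B0)).
exists (Num.truncn (complex.Re B)).+1; rewrite -BE.
by rewrite -(rmorph_nat (real_complex R)) ltcR truncnS_gt.
Qed.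

Lemma half_pow_small (B e : C) : 0 <= B -> 0 < e -> exists n, B / 2 ^+ n < e.
Proof.
move=> B0 e0; have [n Bn] := complex_archimedean (divr_ge0 B0 (ltW e0)).
exists n; rewrite ltr_pdivrMr ?exprn_gt0// mulrC -ltr_pdivrMr//.
by rewrite (lt_le_trans Bn)// -natrX ler_nat ltnW// ltn_expl.
Qed.

(** Limit identities below are checked through this test: their defect is estimated by a fixed
    multiple of 2^-n for every n. *)
Lemma half_pow_eq0 (V : normedZmodType C) (z : V) (B : C) : 0 <= B ->
  (forall n, `|z| <= B / 2 ^+ n) -> z = 0.
Proof.
move=> B0 zB; apply/eqP; rewrite -normr_le0; apply/negP => /negP.
rewrite -real_ltNge ?normr_real// => z0.
by have [n] := half_pow_small B0 z0; move=> /(le_lt_trans (zB n)); rewrite ltxx.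
Qed.

(** The geometric bound forces the Cauchy property; letting [k] grow preserves the non-strict
    estimate, so the limit stays within the radii [e n] themselves. *)
Lemma nested_balls_limit (V : completeNormedModType C) (u : nat -> V)
    (e : nat -> C) (B : C) : 0 <= B -> (forall n, e n <= B / 2 ^+ n) ->
  (forall n k, `|u (n + k)%N - u n| <= e n) ->
  exists l, forall n, `|l - u n| <= e n.
Proof.
move=> B0 eB ue.
have : cvgn u.
  apply: cauchy_cvg; apply: cauchy_exP => eps eps0.
  have [n Bn] := half_pow_small B0 eps0.
  exists (u n); exists n => // m /= nm; rewrite -ball_normE /=.
  by rewrite -(subnKC nm) distrC (le_lt_trans (ue _ _))// (le_lt_trans (eB _)).
case/cvg_ex => l ul; exists l => n; apply/ler_addgt0Pr => eps eps0.
have /cvgrPdist_le /(_ eps eps0) [N _ /(_ (n + N)%N) Nl] := ul.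
have -> : l - u n = (l - u (n + N)%N) + (u (n + N)%N - u n).
  by rewrite addrA subrK.
by rewrite (le_trans (ler_normD _ _))// addrC lerD// Nl//= leq_addl.
Qed.

Lemma bounded_operator_bound (H : hilbertType R) (T : H -> H) :
  bounded_operator T -> exists2 K : C, 0 < K & forall x, `|T x| <= K * `|x|.
Proof.
move=> [lT cT].
pose Tl : {linear H -> H} := HB.pack T (GRing.isLinear.Build _ _ _ _ T lT).
have /linear_boundedP TlB : bounded_near Tl (nbhs (0 : H)).
  exact/continuous_linear_bounded/cT.
have : \forall K \near +oo, 0 < K /\ forall x, `|T x| <= K * `|x|.
  by near=> K; split; [near: K; exact: nbhs_pinfty_gt|near: K; exact: TlB].
case/pinfty_ex_gt0 => // K K0 [_ TK].
by exists K.
Unshelve. all: by end_near. Qed.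

Lemma bounded_operator_of_bound (H : hilbertType R) (T : H -> H) (K : C) :
  linear T -> 0 <= K -> (forall x, `|T x| <= K * `|x|) -> bounded_operator T.
Proof.
move=> lT K0 TK; split=> //.
pose Tl : {linear H -> H} := HB.pack T (GRing.isLinear.Build _ _ _ _ T lT).
apply: (@bounded_linear_continuous _ _ _ Tl); apply/linear_boundedP.
near=> r => x; rewrite (le_trans (TK x))// ler_wpM2r//.
by near: r; apply: nbhs_pinfty_ge; exact: ger0_real.
Unshelve. all: by end_near. Qed.

End complete_spaces.

(** * Quadratic forms on Hilbert spaces *)

Section hilbert_spaces.
Context {R : realType} {H : hilbertType R}.
Local Notation C := R[i].
Implicit Types (x y : H) (T : H -> H).

(** Subtracting from [x] its projection on [y] leaves an orthogonal remainder [u], and Pythagoras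
    gives the estimate. *)
Lemma cauchy_schwarz x y : `|inner x y| <= `|x| * `|y|.
Proof.
have [->|y0] := eqVneq y 0; first by rewrite linear0r normr0 mulr_ge0.
have yy : inner y y != 0 by rewrite inner_norm expf_eq0/= normr_eq0.
have [a xyE] : exists a, inner x y = a * inner y y.
  by exists (inner x y / inner y y); rewrite divfK.
pose u := x - a *: y.
have uy : inner u y = 0 by rewrite linearBl linearZl_LR/= xyE subrr.
have xE : x = u + a *: y by rewrite subrK.
have xx : `|x| ^+ 2 = `|u| ^+ 2 + `|a *: y| ^+ 2.
  by rewrite -!inner_norm {1 2}xE hnormDd// linearZr_LR/= uy mulr0.
rewrite -(@ler_pXn2r _ 2)// ?nnegrE ?mulr_ge0// exprMn xx.
have -> : `|inner x y| ^+ 2 = `|a *: y| ^+ 2 * `|y| ^+ 2.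
  by rewrite xyE inner_norm normrM normrX normr_id normrZ; ring.
by rewrite ler_wpM2r ?exprn_ge0// lerDr exprn_ge0.
Qed.

Lemma parallelogram x y :
  `|x + y| ^+ 2 + `|x - y| ^+ 2 = 2 * `|x| ^+ 2 + 2 * `|y| ^+ 2.
Proof. by rewrite -!inner_norm hnormD hnormB/=; ring. Qed.

End hilbert_spaces.

(** Without a uniform bound there would be nested closed balls, the n-th step making some form
    exceed n; their common point would violate the pointwise bound. *)
Lemma quadratic_uniform_boundedness (R : realType)
    (H : completeNormedModType R[i]) (I : Type) (Q : I -> H -> R[i]) :
  (forall i x y, Q i (x + y) + Q i (x - y) = 2 * Q i x + 2 * Q i y) ->
  (forall i c x, Q i (c *: x) = `|c| ^+ 2 * Q i x) ->
  (forall i x, exists2 K : R[i], 0 < K &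
     forall y, `|y - x| <= 1 -> `|Q i y - Q i x| <= K * `|y - x|) ->
  (forall x, exists B : R[i], forall i, `|Q i x| <= B) ->
  exists2 B : R[i], 0 < B & forall i x, `|Q i x| <= B * `|x| ^+ 2.
Proof.
move=> Qpar Qscale Qlip Qbnd; apply: contrapT => /forall2NP unb.
(* Baire step: s = (n, (x, r)) is a stage and a ball, t a smaller ball inside it
   on which some Q i exceeds n. *)
pose P (s : nat * (H * R[i])) (t : H * R[i]) := 0 < s.2.2 ->
  [/\ 0 < t.2, t.2 <= s.2.2 / 2, `|t.1 - s.2.1| + t.2 <= s.2.2 &
      exists i, forall z, `|z - t.1| <= t.2 -> s.1%:R < `|Q i z|].
(* By the parallelogram law one of Q x, Q (x + w), Q (x - w) is at least Q w / 2
   in absolute value. *)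
have hump s : exists t, P s t.
  case: s => n [x r]; rewrite /P/=.
  have [r0|] := boolP (0 < r); last by exists (x, r).
  (* Rescaling [y] to the vector [w] of norm r/2 turns this [B] into |Q w| > 4 (n + 1), whereas
     values at most n at the three points would give |Q w| <= 2 n. *)
  pose B : R[i] := 16 * n.+1%:R / r ^+ 2.
  have B0 : 0 < B by apply: divr_gt0; [exact: mulr_gt0|exact: exprn_gt0].
  have [i [y Qy]] : exists i y, B * `|y| ^+ 2 < `|Q i y|.
    case: (unb B) => [/negP//|] /existsNP[i /existsNP[y]].
    move/negP; rewrite -real_ltNge ?normr_real//; first by exists i, y.
    by apply: ger0_real; rewrite mulr_ge0 ?exprn_ge0// ltW.
  have y0 : 0 < `|y|.
    rewrite normr_gt0; apply: contraTneq Qy => ->.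
    have -> : Q i 0 = 0 by rewrite -(scaler0 _ 0) Qscale normr0 expr0n mul0r.
    by rewrite !normr0 expr0n mulr0 ltxx.
  pose w := (r / (2 * `|y|)) *: y.
  have wr : `|w| = r / 2.
    rewrite normrZ ger0_norm ?divr_ge0 ?mulr_ge0 ?ltW//.
    by rewrite invfM -!mulrA mulVf ?mulr1// gt_eqF.
  have Qw : 4 * n.+1%:R < `|Q i w|.
    rewrite Qscale normrM normrX normr_id (@ger0_norm _ (_ / _)); last first.
      by rewrite divr_ge0 ?mulr_ge0 ?ltW.
    have -> : 4 * n.+1%:R = (r / (2 * `|y|)) ^+ 2 * (B * `|y| ^+ 2) :> R[i].
      by rewrite /B; field; rewrite !gt_eqF.
    by rewrite ltr_pM2l ?exprn_gt0 ?divr_gt0 ?mulr_gt0.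
  have [v [vx Qv]] : exists v, `|v - x| <= r / 2 /\ n%:R < `|Q i v|.
    have [Qx|Qx] := boolP (n%:R < `|Q i x|).
      by exists x; rewrite subrr normr0 divr_ge0// ltW.
    have [Qp|Qp] := boolP (n%:R < `|Q i (x + w)|).
      by exists (x + w); rewrite addrC addKr wr lexx.
    have [Qm|Qm] := boolP (n%:R < `|Q i (x - w)|).
      by exists (x - w); rewrite addrC addKr normrN wr lexx.
    move: Qx Qp Qm; rewrite -!real_leNgt ?normr_real ?realn// => Qx Qp Qm.
    have : 2 * `|Q i w| <= n%:R + n%:R + 2 * n%:R.
      have -> : 2 * `|Q i w| = `|Q i (x + w) + Q i (x - w) - 2 * Q i x|.
        by rewrite Qpar addrAC subrr add0r normrM ger0_norm.
      rewrite (le_trans (ler_normB _ _))// normrM (@ger0_norm _ 2)//.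
      by rewrite lerD ?ler_pM2l// (le_trans (ler_normD _ _))// lerD.
    move=> /(lt_le_trans _) h; have {h}/h : 2 * (4 * n.+1%:R) < 2 * `|Q i w|.
      by rewrite ltr_pM2l.
    by rewrite -!natrM -!natrD ltr_nat; lia.
  have [K K0 lipK] := Qlip i v.
  pose eps := `|Q i v| - n%:R; have eps0 : 0 < eps by rewrite subr_gt0.
  pose p := r / 2; have p0 : 0 < p by rewrite divr_gt0.
  (* The product a b replaces a minimum: it is at most 1 and at most r/2, and K a b < eps keeps |Q i
     z| above n on the ball. *)
  pose a := p / (1 + p); pose b := eps / (K + eps).
  have a0 : 0 < a by rewrite divr_gt0 ?addr_gt0.
  have Keps : 0 < K + eps by rewrite addr_gt0.
  have b0 : 0 < b by rewrite divr_gt0.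
  have a1 : a <= 1 by rewrite ler_pdivrMr ?addr_gt0// mul1r lerDr.
  have b1 : b <= 1 by rewrite ler_pdivrMr// mul1r lerDr ltW.
  have ap : a <= p.
    by rewrite ler_pdivrMr ?addr_gt0// mulrDr mulr1 lerDl mulr_ge0 ?ltW.
  have Kb : K * b < eps.
    by rewrite mulrA ltr_pdivrMr// mulrC mulrDr ltrDl mulr_gt0.
  have abp : a * b <= p by rewrite (le_trans _ ap)// ger_pMr.
  exists (v, a * b) => _; split => //=; first by rewrite mulr_gt0.
    by rewrite [leRHS](splitr r) lerD.
  exists i => z zv; rewrite -[ltLHS](subKr `|Q i v|) -/eps.
  have zv1 : `|z - v| <= 1 by rewrite (le_trans zv)// mulr_ile1// ltW.
  rewrite ltrBlDl -ltrBlDr (le_lt_trans (lerB_dist _ _))// distrC.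
  rewrite (le_lt_trans (lipK z zv1))// (le_lt_trans _ Kb)// ler_pM2l//.
  by rewrite (le_trans zv)// ger_pMl.
have [g Pg] := choice hump.
pose st := fix st n := if n is m.+1 then g (m, st m) else (0 : H, 1 : R[i]).
have st_gt0 n : 0 < (st n).2.
  by elim: n => [|n IH]//=; case: (Pg (n, st n) IH).
have st_step n := Pg (n, st n) (st_gt0 n).
have [l lst] : exists l, forall n, `|l - (st n).1| <= (st n).2.
  apply: (@nested_balls_limit _ _ _ _ 1) => // [n|n k].
    elim: n => [|n IH]; first by rewrite /= expr0 divr1.
    case: (st_step n) => _ /le_trans h _ _; apply: h.
    by rewrite exprSr invfM mulrA ler_pM2r.
  (* This inequality says that ball n + k lies inside ball n; in this form it passes through the
     induction. *)
  have : `|(st (n + k)%N).1 - (st n).1| + (st (n + k)%N).2 <= (st n).2.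
    elim: k => [|k IH]; first by rewrite addn0 subrr normr0 add0r.
    rewrite addnS; case: (st_step (n + k)%N) => _ _ h _.
    apply: le_trans IH.
    have -> : (st (n + k).+1).1 - (st n).1 =
        ((st (n + k).+1).1 - (st (n + k)%N).1) + ((st (n + k)%N).1 - (st n).1).
      by rewrite addrA subrK.
    apply: (le_trans (lerD (ler_normD _ _) (lexx _))).
    by rewrite addrAC [leLHS]addrC lerD2l.
  by apply: le_trans; rewrite lerDl ltW.
have [B lB] := Qbnd l.
have B0 : 0 <= B.
  by case: (st_step 0) => _ _ _ [i _]; apply: le_trans (lB i).
have [n Bn] := complex_archimedean B0.
(* Ball n + 1 is the one chosen at stage n, hence the shift of index. *)
have [_ _ _ [i /(_ _ (lst n.+1))]] := st_step n.
by move=> /lt_le_trans/(_ (lB i))/(lt_trans Bn); rewrite ltxx.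
Qed.

(** * C*-algebras and their representations *)

Section cstar_algebras.
Context {R : realType} {M : cstarType R}.
Local Notation C := R[i].
Implicit Types (a b u : M) (z : C).

Lemma cmulDl a b c : cmul (a + b) c = cmul a c + cmul b c :> M.
Proof. by have := cmul_linearl c 1 a b; rewrite !scale1r. Qed.

Lemma cmulDr a b c : cmul c (a + b) = cmul c a + cmul c b :> M.
Proof. by have := cmul_linearr c 1 a b; rewrite !scale1r. Qed.

Lemma cmulZl z a c : cmul (z *: a) c = z *: cmul a c :> M.
Proof.
have c0 : cmul 0 c = 0 :> M by apply: (addIr (cmul 0 c)); rewrite -cmulDl !add0r.
by have := cmul_linearl c z a 0; rewrite c0 !addr0.
Qed.

Lemma cmulZr z a c : cmul c (z *: a) = z *: cmul c a :> M.
Proof.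
have c0 : cmul c 0 = 0 :> M by apply: (addIr (cmul c 0)); rewrite -cmulDr !add0r.
by have := cmul_linearr c z a 0; rewrite c0 !addr0.
Qed.

Lemma starD a b : star (a + b) = star a + star b :> M.
Proof. by have := star_semilinear 1 a b; rewrite rmorph1 !scale1r. Qed.

Lemma star0 : star 0 = 0 :> M.
Proof. by apply: (addIr (star 0)); rewrite -starD !add0r. Qed.

Lemma starZ z a : star (z *: a) = Num.conj z *: star a :> M.
Proof. by have := star_semilinear z a 0; rewrite star0 !addr0. Qed.

Lemma star_cone : star cone = cone :> M.
Proof. by rewrite -[RHS]starK -[in RHS](cmul1r (star cone)) starM starK cmul1r. Qed.

(** By the C*-identity |u|^2 is the norm of the unit, which equals its own square and so is 0 (zero
    algebra) or 1. *)
Lemma norm_isometry_le1 u : cmul (star u) u = cone -> `|u| <= 1.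
Proof.
have : `|cone : M| * `|cone : M| = `|cone : M|.
  by rewrite -expr2 -cstar_identity star_cone cmul1r.
move=> c1 uu; have uE : `|u| ^+ 2 = `|cone : M| by rewrite -uu cstar_identity.
rewrite -(@ler_pXn2r _ 2) ?nnegrE// expr1n uE.
have [->|n0] := eqVneq `|cone : M| 0; first exact: ler01.
by rewrite -[X in X <= _](mulfK n0) c1 divff.
Qed.

End cstar_algebras.

Section representations.
Context {R : realType} {M : cstarType R} {H : hilbertType R}.
Variable pi : M -> H -> H.
Hypothesis pi_star : star_representation pi.
Local Notation C := R[i].
Implicit Types (a b u : M) (z : C) (x y : H).

Lemma repD a b x : pi (a + b) x = pi a x + pi b x.
Proof. by case: pi_star => _ /(_ 1 a b x) + _ _ _; rewrite !scale1r. Qed.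

Lemma rep0 x : pi 0 x = 0.
Proof. by apply: (addIr (pi 0 x)); rewrite -repD !add0r. Qed.

Lemma repZ z a x : pi (z *: a) x = z *: pi a x.
Proof. by case: pi_star => _ /(_ z a 0 x) + _ _ _; rewrite rep0 !addr0. Qed.

Lemma repM a b x : pi (cmul a b) x = pi a (pi b x).
Proof. by case: pi_star. Qed.

Lemma rep_linear a : linear (pi a).
Proof. by case: pi_star => /(_ a) []. Qed.

Lemma rep_addr a x y : pi a (x + y) = pi a x + pi a y.
Proof. by have := rep_linear a 1 x y; rewrite !scale1r. Qed.

Lemma rep_oppr a x : pi a (- x) = - pi a x.
Proof.
by apply: (addIr (pi a x)); rewrite -rep_addr !addNr -(scale0r (0 : H));
  apply: (addIr (pi a 0)); rewrite -rep_addr scale0r !add0r.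
Qed.

Lemma rep_scaler a z x : pi a (z *: x) = z *: pi a x.
Proof.
have p0 : pi a 0 = 0 by apply: (addIr (pi a 0)); rewrite -rep_addr !add0r.
by have := rep_linear a z x 0; rewrite p0 !addr0.
Qed.

Lemma rep_adjoint a x y : inner (pi a x) y = inner x (pi (star a) y).
Proof. by case: pi_star => _ _ _ _ /(_ a) ->. Qed.

(** For a self-adjoint element the numerical radius controls the operator norm: polarization and the
    parallelogram law give |a x|^2 <= (B |x|)^2. *)
Lemma rep_numerical_bound a (B : C) : star a = a -> 0 < B ->
  (forall x, `|inner (pi a x) x| <= B * `|x| ^+ 2) ->
  forall x, `|pi a x| <= B * `|x|.
Proof.
move=> sa B0 aB x; pose y := B^-1 *: pi a x.
have Bc : Num.conj B^-1 = B^-1 by apply: CrealP; rewrite realV gtr0_real.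
have iyr : inner (pi a x) y = B^-1 * `|pi a x| ^+ 2.
  by rewrite linearZr_LR/= Bc inner_norm.
have iyl : inner y (pi a x) = B^-1 * `|pi a x| ^+ 2.
  by rewrite linearZl_LR/= inner_norm.
(* Polarization along y = B^-1 a x. *)
have Q4 : 4 * B^-1 * `|pi a x| ^+ 2 =
    inner (pi a (x + y)) (x + y) - inner (pi a (x - y)) (x - y).
  rewrite !rep_addr !rep_oppr !(linearDl, linearDr, linearNl, linearNr)/=.
  rewrite [inner (pi a y) x]rep_adjoint sa iyr iyl; ring.
have : 4 * B^-1 * `|pi a x| ^+ 2 <=
    B * (2 * `|x| ^+ 2 + 2 * (B^-1 ^+ 2 * `|pi a x| ^+ 2)).
  have <- : `|y| ^+ 2 = B^-1 ^+ 2 * `|pi a x| ^+ 2.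
    by rewrite normrZ exprMn ger0_norm// invr_ge0 ltW.
  rewrite -parallelogram mulrDr -[leLHS]ger0_norm; last first.
    by rewrite !mulr_ge0 ?exprn_ge0 ?invr_ge0// ltW.
  by rewrite Q4 (le_trans (ler_normB _ _))// lerD.
have -> : B * (2 * `|x| ^+ 2 + 2 * (B^-1 ^+ 2 * `|pi a x| ^+ 2)) =
    2 * B^-1 * ((B * `|x|) ^+ 2 + `|pi a x| ^+ 2).
  by field; rewrite gt_eqF.
have -> : 4 * B^-1 * `|pi a x| ^+ 2 =
    2 * B^-1 * (`|pi a x| ^+ 2 + `|pi a x| ^+ 2) by ring.
rewrite ler_pM2l ?mulr_gt0 ?invr_gt0// lerD2r => le2.
by rewrite -(@ler_pXn2r _ 2) ?nnegrE ?mulr_ge0// ltW.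
Qed.

End representations.

(** * Bounding the norm of M by the operator norm *)

Section bicommutant.
Context {R : realType} {M : cstarType R} {H : hilbertType R}.
Variable pi : M -> H -> H.
Hypothesis pi_vn : vn_representation pi.
Local Notation C := R[i].

Let pi_star : star_representation pi. Proof. by case: pi_vn. Qed.

Lemma rep_ext (a b : M) : pi a =1 pi b -> a = b.
Proof. by case: pi_vn => _ pi_inj _ ab; apply/pi_inj/funext. Qed.

(** The pointwise limit [T] is linear, is bounded by comparison with [pi (c 0%N)], and commutes with
    the commutant of the range; the bicommutant property then provides an element of [M]
    representing it. *)
Lemma rep_limit (c : nat -> M) :
  (forall n k x, `|pi (c (n + k)%N) x - pi (c n) x| <= `|x| / 2 ^+ n) ->
  exists b, forall n x, `|pi b x - pi (c n) x| <= `|x| / 2 ^+ n.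
Proof.
move=> c_cauchy.
have /choice[T cT] : forall x, exists y, forall n,
    `|y - pi (c n) x| <= `|x| / 2 ^+ n.
  by move=> x; exact: (@nested_balls_limit _ _ _ _ `|x|).
have T_lin : linear T.
  move=> z x y; apply/eqP; rewrite -subr_eq0; apply/eqP.
  apply: (@half_pow_eq0 _ _ _ (`|z *: x + y| + `|z| * `|x| + `|y|)) => [|n].
    by rewrite !addr_ge0// mulr_ge0.
  have -> : T (z *: x + y) - (z *: T x + T y) =
      (T (z *: x + y) - pi (c n) (z *: x + y)) - z *: (T x - pi (c n) x)
      - (T y - pi (c n) y).
    rewrite rep_linear// scalerBr -[RHS]addrA -opprD addrACA -opprD.
    by rewrite opprB addrA subrK.
  rewrite !mulrDl; apply: (le_trans (ler_normB _ _)); rewrite lerD//.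
  apply: (le_trans (ler_normB _ _)); rewrite lerD//.
  by rewrite normrZ -mulrA ler_wpM2l.
have TP : bounded_operator T.
  have [/(_ (c 0%N))/bounded_operator_bound[K K0 cK] _ _ _ _] := pi_star.
  apply: (@bounded_operator_of_bound _ _ _ (1 + K)) => // [|x].
    by rewrite addr_ge0// ltW.
  rewrite -(subrK (pi (c 0%N) x) (T x)) (le_trans (ler_normD _ _))//.
  by rewrite mulrDl mul1r lerD//; have := cT x 0%N; rewrite expr0 divr1.
have : range pi T.
  case: pi_vn => _ _ [_ _ <-]; split=> // U [Ubnd Uc]; apply/funext => x /=.
  have [K K0 UK] := bounded_operator_bound Ubnd.
  have Usub : {morph U : y z / y - z} := zmod_morphism_linear Ubnd.1.
  apply/eqP; rewrite -subr_eq0; apply/eqP.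
  apply: (@half_pow_eq0 _ _ _ (`|U x| + K * `|x|)) => [|n].
    by rewrite addr_ge0// mulr_ge0// ltW.
  have -> : T (U x) - U (T x) =
      (T (U x) - pi (c n) (U x)) - U (T x - pi (c n) x).
    have /(congr1 (@^~ x))/= <- : U \o pi (c n) = pi (c n) \o U.
      by apply: Uc; exists (c n).
    by rewrite Usub opprB addrA subrK.
  rewrite mulrDl; apply: (le_trans (ler_normB _ _)); rewrite lerD//.
  by rewrite -mulrA (le_trans (UK _))// ler_pM2l.
by case=> b _ bT; exists b => n x; rewrite bT.
Qed.

Variable k : M.
Hypothesis k_self : star k = k.
Hypothesis k_half : forall x, `|pi k x| <= 2^-1 * `|x|.

(** For b = 1 - c the equation c = (k^2 + c^2) / 2 reads b^2 = 1 - k^2. The iterates are real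
    polynomials in [k], hence self-adjoint and commuting with [k]. *)
Fixpoint sqrt_iter n : M :=
  if n is m.+1
  then 2^-1 *: (cmul k k + cmul (sqrt_iter m) (sqrt_iter m)) else 0.

Let half_conj : Num.conj (2^-1 : C) = 2^-1.
Proof. by apply: CrealP; rewrite realV realn. Qed.

Lemma star_sqrt_iter n : star (sqrt_iter n) = sqrt_iter n.
Proof.
elim: n => [|n IH]; rewrite /= ?star0//.
by rewrite starZ half_conj starD !starM k_self IH.
Qed.

Lemma sqrt_iter_comm n : cmul k (sqrt_iter n) = cmul (sqrt_iter n) k.
Proof.
elim: n => [|n IH] /=.
  by rewrite -(scale0r (0 : M)) cmulZl cmulZr !scale0r.
by rewrite cmulZl cmulZr cmulDl cmulDr cmulA cmulA IH -!cmulA IH.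
Qed.

Lemma sqrt_iterE n x : pi (sqrt_iter n.+1) x =
  2^-1 *: (pi k (pi k x) + pi (sqrt_iter n) (pi (sqrt_iter n) x)).
Proof. by rewrite /= repZ// repD// !repM. Qed.

Lemma norm_half (x : H) : `|2^-1 *: x| = 2^-1 * `|x|.
Proof. by rewrite normrZ ger0_norm. Qed.

(** The ball of radius 1/2 is invariant: bounding each of the two squares by 1/2 already suffices
    for their mean. *)
Lemma sqrt_iter_half n x : `|pi (sqrt_iter n) x| <= 2^-1 * `|x|.
Proof.
elim: n x => [|n IH] x; first by rewrite rep0// normr0 mulr_ge0.
rewrite sqrt_iterE norm_half ler_pM2l//.
have step (T : H -> H) : (forall y, `|T y| <= 2^-1 * `|y|) ->
    `|T (T x)| <= 2^-1 * `|x|.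
  move=> hT; apply: (le_trans (hT _)); rewrite ler_pM2l//.
  by apply: (le_trans (hT _)); rewrite ler_piMl// invf_le1 ?ler1n.
rewrite (le_trans (ler_normD _ _))// [leRHS](_ : _ = 2^-1 * `|x| + 2^-1 * `|x|).
  by rewrite lerD// step.
by field.
Qed.

(** With s^2 - t^2 = s (s - t) + (s - t) t and both factors of norm at most 1/2, the averaging
    factor 1/2 halves the difference at each step. *)
Lemma sqrt_iter_step n x :
  `|pi (sqrt_iter n.+1) x - pi (sqrt_iter n) x| <= `|x| / 2 ^+ n.+1.
Proof.
elim: n x => [|n IH] x.
  by rewrite [pi (sqrt_iter 0) x]rep0// subr0 expr1 mulrC sqrt_iter_half.
rewrite sqrt_iterE [X in _ - X]sqrt_iterE -scalerBr norm_half.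
set s := sqrt_iter n.+1; set t := sqrt_iter n.
have -> : pi k (pi k x) + pi s (pi s x) - (pi k (pi k x) + pi t (pi t x)) =
    pi s (pi s x - pi t x) + (pi s (pi t x) - pi t (pi t x)).
  by rewrite opprD addrACA subrr add0r rep_addr// rep_oppr// addrA subrK.
rewrite exprSr invfM mulrA [leRHS]mulrC ler_pM2l//.
apply: (le_trans (ler_normD _ _)); rewrite [leRHS]splitr lerD//.
  by apply: (le_trans (sqrt_iter_half _ _)); rewrite mulrC ler_pM2r// IH.
apply: (le_trans (IH _)); rewrite mulrAC ler_pM2r ?invr_gt0 ?exprn_gt0//.
by rewrite mulrC sqrt_iter_half.
Qed.

Lemma sqrt_iter_cauchy n m x :
  `|pi (sqrt_iter (n + m)%N) x - pi (sqrt_iter n) x| <= `|x| / 2 ^+ n.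
Proof.
(* The induction carries the exact geometric sum of the step bounds. *)
suff : `|pi (sqrt_iter (n + m)%N) x - pi (sqrt_iter n) x| <=
    `|x| / 2 ^+ n - `|x| / 2 ^+ (n + m).
  move=> /le_trans; apply; rewrite lerBlDr lerDl.
  by rewrite divr_ge0// exprn_ge0.
elim: m => [|m IH]; first by rewrite addn0 !subrr normr0.
rewrite addnS -(subrK (pi (sqrt_iter (n + m)%N) x) (pi (sqrt_iter _.+1) x)).
rewrite -addrA.
apply: (le_trans (ler_normD _ _)); apply: (le_trans (lerD (sqrt_iter_step _ _) IH)).
rewrite le_eqVlt; apply/orP; left; apply/eqP; rewrite exprSr; field.
by rewrite !expf_neq0.
Qed.

(* [c = 1 - sqrt (1 - k^2)] is the fixed point of [c |-> (k^2 + c^2) / 2]. *)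
Lemma sqrt_fixpoint : exists c : M, [/\ star c = c, cmul k c = cmul c k &
  c = 2^-1 *: (cmul k k + cmul c c)].
Proof.
have [c c_lim] := rep_limit sqrt_iter_cauchy.
have c0 x : `|pi c x| <= `|x|.
  by have := c_lim 0%N x; rewrite rep0// subr0 expr0 divr1.
exists c; split.
- apply: rep_ext => x; apply/eqP; rewrite -subr_eq0 -(dnorm_eq0 inner).
  move yE : (_ - _) => y; apply/eqP.
  apply: (@half_pow_eq0 _ _ _ (2 * `|x| * `|y|)) => [|n].
    by rewrite !mulr_ge0.
  pose s := sqrt_iter n.
  (* Pairing the defect y = c* x - c x with itself leaves only differences between [c] and [s],
     because [s] is self-adjoint. *)
  have -> : inner y y = inner x (pi c y - pi s y) - inner (pi c x - pi s x) y.
    rewrite -{1}yE !linearBl !linearBr/= (rep_adjoint pi_star (star c)) starK.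
    rewrite (rep_adjoint pi_star s) star_sqrt_iter.
    by rewrite opprB addrA subrK.
  apply: (le_trans (ler_normB _ _)).
  have -> : 2 * `|x| * `|y| / 2 ^+ n =
      `|x| * (`|y| / 2 ^+ n) + `|x| / 2 ^+ n * `|y|.
    by field; rewrite expf_neq0.
  apply: lerD; apply: (le_trans (cauchy_schwarz _ _)).
    by rewrite ler_wpM2l//; exact: c_lim.
  by rewrite ler_wpM2r//; exact: c_lim.
- apply: rep_ext => x; apply/eqP; rewrite -subr_eq0 !repM//; apply/eqP.
  apply: (@half_pow_eq0 _ _ _ (`|x| + `|pi k x|)) => [|n].
    by rewrite addr_ge0.
  pose s := sqrt_iter n.
  have -> : pi k (pi c x) - pi c (pi k x) =
      pi k (pi c x - pi s x) - (pi c (pi k x) - pi s (pi k x)).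
    rewrite rep_addr// rep_oppr// -(repM pi_star k s) sqrt_iter_comm repM//.
    by rewrite opprB addrA subrK.
  apply: (le_trans (ler_normB _ _)); rewrite mulrDl; apply: lerD; last exact: c_lim.
  apply: (le_trans (k_half _)); rewrite (le_trans _ (c_lim n x))//.
  by rewrite ler_piMl// invf_le1 ?ler1n.
- apply: rep_ext => x; apply/eqP; rewrite -subr_eq0; apply/eqP.
  apply: (@half_pow_eq0 _ _ _ (`|x| + (`|pi c x| + `|x|))) => [|n].
    by rewrite !addr_ge0.
  pose s := sqrt_iter n.
  rewrite repZ// repD// !repM//.
  (* The recursion for [sqrt_iter n.+1] is subtracted, and c^2 - s^2 is split as (c - s) c + s (c -
     s). *)
  have -> : pi c x - 2^-1 *: (pi k (pi k x) + pi c (pi c x)) =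
      (pi c x - pi (sqrt_iter n.+1) x)
      - 2^-1 *: ((pi c (pi c x) - pi s (pi c x)) + pi s (pi c x - pi s x)).
    have -> : pi c (pi c x) - pi s (pi c x) + pi s (pi c x - pi s x) =
        pi c (pi c x) - pi s (pi s x).
      by rewrite rep_addr// rep_oppr// addrA subrK.
    rewrite sqrt_iterE -/s -[RHS]addrA -opprD -scalerDr; congr (_ - _ *: _).
    by rewrite -[RHS]addrA; congr (_ + _); rewrite addrC subrK.
  apply: (le_trans (ler_normB _ _)); rewrite mulrDl lerD//.
    apply: (le_trans (c_lim _ _)); rewrite ler_wpM2l// lef_pV2 ?posrE ?exprn_gt0//.
    by rewrite ler_eXn2l ?ltr1n.
  rewrite norm_half; set z := (X in `|X|).
  apply: (@le_trans _ _ `|z|).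
    by rewrite ler_piMl// invf_le1 ?ler1n.
  apply: (le_trans (ler_normD _ _)); rewrite mulrDl; apply: lerD; first exact: c_lim.
  apply: (le_trans (sqrt_iter_half _ _)).
  by rewrite (le_trans _ (c_lim n x))// ler_piMl// invf_le1 ?ler1n.
Qed.

(** The unitaries [u] and [v] are bounded through the C*-identity alone, in the norm of [M]. The
    loss of a factor 2 is harmless, since only boundedness is to be transferred. *)
Lemma norm_selfadjoint_le1 : `|k| <= 1.
Proof.
have [c [sc kc cE]] := sqrt_fixpoint.
pose b : M := cone - c.
have sb : star b = b.
  by rewrite /b -scaleN1r starD starZ sc star_cone rmorphN rmorph1.
have kb : cmul k b = cmul b k.
  by rewrite /b -scaleN1r cmulDl cmulDr cmulZl cmulZr kc cmulr1 cmul1r.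
have kkbb : cmul k k + cmul b b = cone.
  rewrite /b -scaleN1r cmulDl !cmulDr !cmul1r cmulr1 !cmulZl !cmulZr !scaleN1r.
  have ccE : c + c = cmul k k + cmul c c.
    by rewrite [in LHS]cE -scalerDl -[X in X *: _](_ : 1 = _) ?scale1r//; field.
  rewrite opprK.
  rewrite [cone - c + _]addrA -[cone - c - c]addrA -opprD ccE.
  by rewrite addrA addrAC addrC subrK.
pose u : M := k + 'i *: b; pose v : M := k - 'i *: b.
have su : star u = v by rewrite starD starZ k_self sb conjCi scaleNr.
have sv : star v = u by rewrite -su starK.
have vu : cmul v u = cone.
  rewrite /u /v -scaleNr cmulDl !cmulDr !cmulZl !cmulZr scalerA.
  rewrite mulNr -expr2 sqrCi opprK scale1r.
  by rewrite kb addrA -[X in X + _]addrA -scalerDl subrr scale0r addr0.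
have uv : cmul u v = cone.
  rewrite /u /v -scaleNr cmulDl !cmulDr !cmulZl !cmulZr scalerA.
  rewrite mulrN -expr2 sqrCi opprK scale1r.
  by rewrite kb addrA -[X in X + _]addrA -scalerDl addNr scale0r addr0.
have u1 : `|u| <= 1 by apply: norm_isometry_le1; rewrite su.
have v1 : `|v| <= 1 by apply: norm_isometry_le1; rewrite sv.
have -> : k = 2^-1 *: (u + v).
  rewrite addrACA subrr addr0 scalerDr -scalerDl.
  by rewrite -[X in X *: _](_ : 1 = _) ?scale1r//; field.
rewrite normrZ ger0_norm// ler_pdivrMl// mulr1 (le_trans (ler_normD _ _))//.
exact: lerD.
Qed.

End bicommutant.

(** * Vector states *)

Section numerical_radius.
Context {R : realType} {M : cstarType R} {H : hilbertType R}.
Variable pi : M -> H -> H.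
Hypothesis pi_vn : vn_representation pi.
Local Notation C := R[i].

Let pi_star : star_representation pi. Proof. by case: pi_vn. Qed.

(** The sum has numerical radius at most 2 B, hence operator norm at most 2 B; dividing by 4 B
    reaches the threshold 1/2. *)
Lemma norm_add_star_le (a : M) (B : C) : 0 < B ->
  (forall x, `|inner (pi a x) x| <= B * `|x| ^+ 2) -> `|a + star a| <= 4 * B.
Proof.
move=> B0 aB; set h := a + star a.
have h_self : star h = h by rewrite starD starK addrC.
have hB : forall x, `|pi h x| <= 2 * B * `|x|.
  apply: rep_numerical_bound => // [|x]; first exact: mulr_gt0.
  rewrite repD// linearDl/= [inner (pi (star a) x) x](rep_adjoint pi_star) starK.
  rewrite (le_trans (ler_normD _ _))// -mulrA mulr_natl mulr2n lerD//.
  by rewrite hermC/= mul1r norm_conjC.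
have -> : h = (4 * B) *: ((4 * B)^-1 *: h).
  by rewrite scalerA divff ?scale1r// gt_eqF// mulr_gt0.
rewrite normrZ ger0_norm ?mulr_ge0 ?(ltW B0)// ler_piMr ?mulr_ge0 ?(ltW B0)//.
apply: (norm_selfadjoint_le1 pi_vn) => [|x].
  rewrite starZ h_self; congr (_ *: _).
  by apply: CrealP; rewrite realV gtr0_real// mulr_gt0.
rewrite repZ// normrZ ger0_norm ?invr_ge0 ?mulr_ge0 ?(ltW B0)//.
rewrite ler_pdivrMl ?mulr_gt0//.
have -> : 4 * B * (2^-1 * `|x|) = 2 * B * `|x| by field.
exact: hB.
Qed.

(** The hypothesis is invariant under a -> i a, so the previous bound covers both the real and the
    imaginary part of [a]. *)
Lemma norm_le_numerical_radius (a : M) (B : C) : 0 < B ->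
  (forall x, `|inner (pi a x) x| <= B * `|x| ^+ 2) -> `|a| <= 4 * B.
Proof.
move=> B0 aB.
have h1 := norm_add_star_le B0 aB.
have h2 : `|'i *: a + star ('i *: a)| <= 4 * B.
  apply: norm_add_star_le => // x.
  by rewrite repZ// linearZl_LR/= normrM normCi mul1r.
have i1 : - 'i * 'i = 1 :> C by rewrite mulNr -expr2 sqrCi opprK.
have i2 : - 'i * - 'i = -1 :> C by rewrite mulrNN -expr2 sqrCi.
have sub_star : - 'i *: ('i *: a + star ('i *: a)) = a - star a.
  by rewrite starZ conjCi scalerDr !scalerA i1 i2 scale1r scaleN1r.
have -> : a = 2^-1 *: ((a + star a) + - 'i *: ('i *: a + star ('i *: a))).
  rewrite sub_star addrACA subrr addr0 scalerDr -scalerDl.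
  by rewrite -[X in X *: _](_ : 1 = _) ?scale1r//; field.
rewrite normrZ ger0_norm// ler_pdivrMl// (le_trans (ler_normD _ _))//.
rewrite (_ : 2 * (4 * B) = 4 * B + 4 * B); last by ring.
by rewrite lerD// normrZ normrN normCi mul1r.
Qed.

Lemma norm_bounded_of_vector_forms (I : Type) (f : I -> M) :
  (forall x, exists B : C, forall i, `|inner (pi (f i) x) x| <= B) ->
  exists2 B : C, 0 < B & forall i, `|f i| <= B.
Proof.
move=> fB.
have [||| |B B0 QB] :=
    @quadratic_uniform_boundedness R H I (fun i x => inner (pi (f i) x) x).
- move=> i x y; rewrite !rep_addr// !rep_oppr//.
  by rewrite !(linearDl, linearDr, linearNl, linearNr)/=; ring.
- move=> i c x; rewrite rep_scaler// linearZl_LR linearZr_LR/=.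
  by rewrite mulrA normCK.
- move=> i x; have [/(_ (f i))/bounded_operator_bound[K K0 fK] _ _ _ _] := pi_star.
  (* The increment of the form is split into two terms; |y| <= |x| + 1 bounds one, |x| the other. *)
  exists (K * (`|x| + 1 + `|x|)) => [|y yx].
    by rewrite mulr_gt0// ltr_wpDr// ltr_wpDl.
  have -> : inner (pi (f i) y) y - inner (pi (f i) x) x =
      inner (pi (f i) (y - x)) y + inner (pi (f i) x) (y - x).
    by rewrite rep_addr// rep_oppr// linearBl linearBr/= addrA subrK.
  apply: (le_trans (ler_normD _ _)).
  have -> : K * (`|x| + 1 + `|x|) * `|y - x| =
      K * `|y - x| * (`|x| + 1) + K * `|x| * `|y - x| by ring.
  apply: lerD; apply: (le_trans (cauchy_schwarz _ _)); last by rewrite ler_wpM2r.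
  apply: ler_pM => //.
  by rewrite -[y in leLHS](subrK x) addrC (le_trans (ler_normD _ _))// lerD.
- by [].
exists (4 * B) => [|i]; first exact: mulr_gt0.
exact: norm_le_numerical_radius (QB i).
Qed.

End numerical_radius.

Section vector_states.
Context {R : realType} {M : wstarType R}.
Local Notation C := R[i].

Lemma vector_state (H : hilbertType R) (pi : M -> H -> H) (x : H) :
  vn_representation pi -> `|x| = 1 ->
  exists rho : normal_state M, forall a, rho a = inner (pi a x) x.
Proof.
move=> pi_vn x1; have [pi_star _ _] := pi_vn.
have series_first (V : normedModType C) (u : nat -> V) :
    (forall n, u n.+1 = 0) -> series u @ \oo --> u 0%N.
  (* [series u n] sums the indices below n, so it is constant only from n = 1 on. *)
  move=> u0; apply: cvg_near_cst; exists 1%N => // -[|n] //= _.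
  by rewrite /series/= big_nat_recl// big1 ?addr0.
have normal : normal_functional (fun a => inner (pi a x) x).
  exists H, pi; split=> //.
  pose xi (n : nat) : H := if n is 0%N then x else 0.
  exists xi, xi; split.
  - apply/cvg_ex; exists (`|x| ^+ 2 : C).
    apply: (@series_first C^o (fun n => `|xi n| ^+ 2)) => n.
    by rewrite /= normr0 expr0n.
  - apply/cvg_ex; exists (`|x| ^+ 2 : C).
    apply: (@series_first C^o (fun n => `|xi n| ^+ 2)) => n.
    by rewrite /= normr0 expr0n.
  - move=> a; apply: (@series_first C^o (fun n => inner (pi a (xi n)) (xi n))).
    by move=> n; rewrite /= linear0r.
have ge0 a : 0 <= inner (pi (cmul (star a) a) x) x.
  by rewrite repM// rep_adjoint// starK dnorm_ge0.
have one : inner (pi cone x) x = 1.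
  by case: pi_star => _ _ _ -> _; rewrite inner_norm x1 expr1n.
by exists (NormalState normal ge0 one).
Qed.

(** Homogeneity is read off termwise from the defining series, by uniqueness of limits; it evaluates
    a state on multiples of the unit. *)
Lemma normal_functionalZ (phi : M -> C) (z : C) (a : M) :
  normal_functional phi -> phi (z *: a) = z * phi a.
Proof.
move=> [H [pi [[pi_star _ _] [xi [eta [_ _ phiE]]]]]].
have h : series (fun n => inner (pi (z *: a) (xi n)) (eta n) : C^o) @ \oo -->
    (z *: (phi a : C^o)).
  rewrite (_ : series _ = (fun n =>
      z *: (series (fun n => inner (pi a (xi n)) (eta n) : C^o) n))).
    by apply: cvgZr; exact: phiE.
  apply/funext => n; rewrite /series/= scaler_sumr; apply: eq_bigr => i _.
  by rewrite repZ// linearZl_LR.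
exact: (cvg_unique _ (phiE (z *: a)) h).
Qed.

End vector_states.

(** * Probability measures that make an unbounded function non-integrable *)

Section unit_mass.
Context (R : realType) d (T : measurableType d).
Variable mu : {measure set T -> \bar R}.
Hypothesis muT : mu setT = 1%E.

(** A copy of [mu] indexed by the proof of total mass 1, to which the probability structure can be
    attached. *)
Definition unit_mass of mu setT = 1%E := Measure.sort mu.

HB.instance Definition _ := Measure.on (unit_mass muT).

HB.instance Definition _ :=
  Measure_isProbability.Build d T R (unit_mass muT) muT.

End unit_mass.

Lemma unbounded_not_integrable (R : realType) d (T : measurableType d)
    (g : T -> R) : measurable_fun setT g ->
  (forall B, exists x, B < `|g x|) ->
  exists P : probability T R, ~ P.-integrable setT (EFin \o g).
Proof.
move=> mg g_unb.
have /choice[x xP] : forall n : nat, exists x, n%:R * (2 ^ n.+1)%:R < `|g x|.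
  by move=> n; exact: g_unb.
have w_ge0 n : 0 <= 1 / (2 ^ n.+1)%:R :> R by rewrite divr_ge0.
pose w n : {nonneg R} := NngNum (w_ge0 n).
pose mu : {measure set T -> \bar R} :=
  mseries (fun n => mscale (w n) \d_(x n)) 0.
have muT : mu setT = 1%E.
  rewrite /mu /= /mseries/=.
  under eq_eseriesr do rewrite /mscale/= diracT mule1.
  have := @cvg_geometric_eseries_half R 1 0.
  rewrite expr0 divr1 => /(cvg_lim (@ereal_hausdorff R)) <-.
  congr (limn _); apply/funext => n; apply: eq_bigr => i _.
  by rewrite addn1.
have mabs : measurable_fun setT (fun y => `|(g y)%:E|%E).
  by apply: measurableT_comp => //; exact/measurable_EFinP.
have int_ge n : (n%:R%:E <= \int[mu]_y `|(g y)%:E|)%E.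
  rewrite ge0_integral_measure_series//.
  have term_ge0 k : (0 <= \int[mscale (w k) \d_(x k)]_y `|(g y)%:E|)%E.
    exact: integral_ge0.
  (* The first n + 1 terms are kept, so that the last one is atom n: the factor 2^(n+1) in the
     choice of x_n cancels its weight and leaves more than n. *)
  apply: le_trans (nneseries_lim_ge n.+1 (fun k _ _ => term_ge0 k)).
  rewrite big_nat_recr//= ge0_integral_mscale// integral_dirac// diracT mul1e.
  rewrite -[leLHS]add0e leeD//; first exact: sume_ge0.
  by rewrite /w/= lee_fin ltW// div1r mulrC ltr_pdivlMr.
exists (unit_mass muT); move=> /integrableP[_ /= int_fin].
have intE : ((fine (\int[mu]_y `|(g y)%:E|))%:E = \int[mu]_y `|(g y)%:E|)%E.
  by rewrite fineK// ge0_fin_numE//; exact: integral_ge0.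
have := int_ge (Num.truncn (fine (\int[mu]_y `|(g y)%:E|)%E)).+1.
by rewrite -[leRHS]intE lee_fin leNgt truncnS_gt.
Qed.

Lemma complex_norm_le (R : realType) (z : R[i]) :
  `|z| <= (`|complex.Re z| + `|complex.Im z|)%:C.
Proof.
have norm_real (r : R) : `|r%:C| = `|r|%:C.
  by rewrite normc_def/= expr0n addr0 sqrtr_sqr.
have norm_i : `|('i : R[i])%C| = 1.
  by rewrite normc_def/= expr0n add0r expr1n sqrtr1.
rewrite [z in leLHS]complexE (le_trans (ler_normD _ _))// normrM norm_i mul1r.
by rewrite rmorphD/= !norm_real.
Qed.

Theorem proposition4p2 (R : realType) (d : measure_display)
    (Sigma : measurableType d) (MS : wstarType R) (f : Sigma -> MS)
    (hf : ultraweakly_measurable f)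
    (hunb : ereal_sup [set (complex.Re `|f x|)%:E | x in [set: Sigma]] = +oo%E) :
  exists (MR : wstarType R) (E : povm Sigma MR),
    forall (T : wstarType R) (tau : MS -> MR -> T), spatial_tensor tau ->
      ~ exists A : T, characterizing_formula tau f E A.
Proof.
have [rho rho_unb] : exists rho : normal_state MS,
    ~ exists B : R[i], forall x, `|rho (f x)| <= B.
  apply: contrapT => /forallNP rho_bnd.
  have [H [pi pi_vn]] := @wstar_representable R MS.
  have [pi_star _ _] := pi_vn.
  have [|B B0 fB] := norm_bounded_of_vector_forms pi_vn (f := f).
    move=> x; have [->|x0] := eqVneq x 0.
      by exists 0 => y; rewrite linear0r normr0.
    pose y := `|x|^-1 *: x.
    have y1 : `|y| = 1.
      by rewrite normrZ ger0_norm ?invr_ge0// mulVf// normr_eq0.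
    have [rho rhoE] := vector_state pi_vn y1.
    have [B rhoB] := contrapT (rho_bnd rho).
    exists (`|x| ^+ 2 * B) => s.
    (* Homogeneity of the form transfers the bound for the vector state of [y] to [x]. *)
    have -> : x = `|x| *: y by rewrite scalerA divff ?scale1r// normr_eq0.
    rewrite rep_scaler// linearZl_LR linearZr_LR/= !normrM norm_conjC normr_id.
    rewrite mulrA -expr2 normrZ y1 mulr1 normr_id.
    by rewrite ler_wpM2l ?exprn_ge0// -rhoE.
  have : (ereal_sup [set (complex.Re `|f x|)%:E | x in [set: Sigma]] <=
      (complex.Re B)%:E)%E.
    apply: ge_ereal_sup => _ [x _ <-]; rewrite lee_fin.
    by have := fB x; rewrite lecE => /andP[].
  by rewrite hunb leye_eq.
pose g := fun x => rho (f x).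
have [mRe mIm] := hf rho (ns_normal rho).
have [P not_int] : exists P : probability Sigma R, ~ integrableC P g.
  have [Re_unb|/existsNP[B1 /forallNP ReB]] :=
    pselect (forall B, exists x, B < `|complex.Re (g x)|).
    have [P nP] := unbounded_not_integrable mRe Re_unb.
    by exists P => -[/nP].
  have [Im_unb|/existsNP[B2 /forallNP ImB]] :=
    pselect (forall B, exists x, B < `|complex.Im (g x)|).
    have [P nP] := unbounded_not_integrable mIm Im_unb.
    by exists P => -[_ /nP].
  exfalso; apply: rho_unb; exists (B1 + B2)%:C => x.
  rewrite (le_trans (complex_norm_le _))// lecR.
  by apply: lerD; rewrite leNgt; apply/negP; first [exact: ReB|exact: ImB].
pose eff (X : set Sigma) : MS := (fine (P X))%:C *: cone.
(* A nonnegative multiple r of the unit is the square of sqrt r times the unit; with r = 1 - P(X)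
   this also gives the upper bound in [Eff]. *)
have effE X (r : R) : 0 <= r -> cstar_le 0 (r%:C *: cone : MS).
  move=> r0; exists ((Num.sqrt r)%:C *: cone).
  rewrite subr0 starZ star_cone cmulZl cmulZr cmul1r scalerA.
  rewrite conj_Creal ?ger0_real ?ler0c ?sqrtr_ge0//.
  by rewrite -rmorphM -expr2 sqr_sqrtr.
have eff_Eff X : measurable X -> Eff (eff X).
  move=> mX; split; first exact/effE/fine_ge0.
  have [c cE] : cstar_le 0 ((1 - fine (P X))%:C *: cone : MS).
    apply: effE => //; rewrite subr_ge0 -lee_fin fineK ?fin_num_measure//.
    exact: probability_le1.
  by exists c; rewrite -cE subr0 rmorphB rmorph1 scalerBl scale1r.
have eff_measure (omega : normal_state MS) X : measurable X ->
    omega (eff X) = (fine (P X))%:C.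
  move=> mX; rewrite /eff normal_functionalZ ?ns_one ?mulr1//.
  exact: ns_normal.
exists MS, (Povm eff_Eff (povm_measure := fun=> P) eff_measure).
(* As M_R = M_S, [rho] also serves as the state omega, and the integrability clause fails for this
   pair. *)
by move=> T tau _ [A /(_ rho rho)[]].
Qed.
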